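(* Let $A$ and $A^*$ be dagger dual objects in a monoidal dagger category. There is a one-to-one correspondence between symmetric dagger Frobenius 2-structures $(\mu,u)$ on $A$ and unital dagger Frobenius 3-structures $(m,u)$ on $A$ (with chosen unit $u$). It is given as follows, with the same unit $u\colon I\to A$ on both sides. - From a 2-structure to a 3-structure: $$m=\mu\circ(\mu\otimes\mathrm{id}_A)\circ(\mathrm{id}_A\otimes j^\dagger\otimes\mathrm{id}_A)\colon A\otimes A^*\otimes A\to A,$$ where $j\colon A\to A^*$ is the involution of $\mu$. - From a 3-structure to a 2-structure: $$\mu=m\circ(\mathrm{id}_A\otimes u_*\otimes\mathrm{id}_A)\colon A\otimes A\to A.$$ Moreover, the following are equivalent for corresponding structures: the Frobenius 2-structure is special; the Frobenius 3-structure is normal; the Frobenius 3-structure is left idempotent or right idempotent.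
   Context: Monoidal categories are treated as strict. **Dagger duals.** In a monoidal dagger category, $A$ and $A^*$ are dagger dual when there are $\eta\colon I\to A^*\otimes A$ and $\varepsilon\colon A\otimes A^*\to I$ with $(\varepsilon\otimes\mathrm{id}_A)(\mathrm{id}_A\otimes\eta)=\mathrm{id}_A$ and $(\mathrm{id}_{A^*}\otimes\varepsilon)(\eta\otimes\mathrm{id}_{A^*})=\mathrm{id}_{A^*}$, together with $\eta'=\varepsilon^\dagger\colon I\to A\otimes A^*$ and $\varepsilon'=\eta^\dagger\colon A^*\otimes A\to I$ (which make $A$ a left dual of $A^*$). For $u\colon I\to A$, set $u_*=(u^\dagger\otimes\mathrm{id}_{A^*})\circ\eta'\colon I\to A^*$. **2-structures.** A dagger Frobenius (2-)structure on $A$ is a monoid $(\mu\colon A\otimes A\to A,\ u\colon I\to A)$ satisfying $(\mu\otimes\mathrm{id}_A)(\mathrm{id}_A\otimes\mu^\dagger)=(\mathrm{id}_A\otimes\mu)(\mu^\dagger\otimes\mathrm{id}_A)$; its comultiplication is $\mu^\dagger$ and its counit is $u^\dagger$. It is special when $\mu\circ\mu^\dagger=\mathrm{id}_A$. It is symmetric when the two morphisms $A\to A^*$ $$\big((u^\dagger\circ\mu)\otimes\mathrm{id}_{A^*}\big)\circ(\mathrm{id}_A\otimes\eta')\quad\text{and}\quad\big(\mathrm{id}_{A^*}\otimes(u^\dagger\circ\mu)\big)\circ(\eta\otimes\mathrm{id}_A)$$ coincide; this common morphism is the involution $j\colon A\to A^*$. **3-structures.** A dagger Frobenius 3-structure on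 $A$ is a morphism $m\colon A\otimes A^*\otimes A\to A$ satisfying $m(\mathrm{id}_A\otimes\mathrm{id}_{A^*}\otimes m)=m(m\otimes\mathrm{id}_{A^*}\otimes\mathrm{id}_A)$ and $$(m\otimes\mathrm{id}_{A^*}\otimes\mathrm{id}_A)(\mathrm{id}_A\otimes\mathrm{id}_{A^*}\otimes\eta'\otimes\mathrm{id}_A)(\mathrm{id}_A\otimes\eta)=m^\dagger=(\mathrm{id}_A\otimes\mathrm{id}_{A^*}\otimes m)(\mathrm{id}_A\otimes\eta\otimes\mathrm{id}_{A^*}\otimes\mathrm{id}_A)(\eta'\otimes\mathrm{id}_A).$$ - It is unital, with unit $u\colon I\to A$, when $m\circ(u\otimes u_*\otimes\mathrm{id}_A)=\mathrm{id}_A=m\circ(\mathrm{id}_A\otimes u_*\otimes u)$. - It is normal when $m\circ(\eta'\otimes\mathrm{id}_A)=\mathrm{id}_A=m\circ(\mathrm{id}_A\otimes\eta)$. - It is left idempotent when $l_A=(\mathrm{id}_{A^*}\otimes m)\circ(\eta\otimes\mathrm{id}_{A^*}\otimes\mathrm{id}_A)\colon A^*\otimes A\to A^*\otimes A$ is idempotent. - It is right idempotent when $r_A=(m\otimes\mathrm{id}_{A^*})\circ(\mathrm{id}_A\otimes\mathrm{id}_{A^*}\otimes\eta')\colon A\otimes A^*\to A\otimes A^*$ is idempotent.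
   Formalization: As stated the bijection fails (scalars, A=A*=I, η=1/2, ε=2, u=1, m=1/2); the 3-structures are restricted to units with (u†⊗id)∘η' = (id⊗u†)∘η, a condition proved to hold for units of all symmetric 2-structures. *)

(* Defs.v *)
From mathcomp Require Import ssreflect ssrfun.

Set Implicit Arguments.
Unset Strict Implicit.
Unset Printing Implicit Defensive.

Declare Scope ob_scope.
Declare Scope arr_scope.
Delimit Scope ob_scope with ob.
Delimit Scope arr_scope with arr.

(* A strict monoidal dagger category, presented as a category internal to
   monoids: objects and arrows both form monoids under the tensor, and dom, cod,
   identities and composition respect them.  Keeping all arrows in one type makes
   strictness a plain equality, with no transport along A ⊗ (B ⊗ C) = (A ⊗ B) ⊗ C.
   [acomp g f] is "g after f"; it is a total function, but its value is
   constrained only when cod f = dom g, and it is only used in that case. *)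
Record strict_monoidal_dagger_category := StrictMonoidalDaggerCategory {
  ob : Type;
  arr : Type;
  dom : arr -> ob;
  cod : arr -> ob;
  idm : ob -> arr;
  acomp : arr -> arr -> arr;
  dom_idm : forall A, dom (idm A) = A;
  cod_idm : forall A, cod (idm A) = A;
  dom_comp : forall g f, cod f = dom g -> dom (acomp g f) = dom f;
  cod_comp : forall g f, cod f = dom g -> cod (acomp g f) = cod g;
  comp_idl : forall f, acomp (idm (cod f)) f = f;
  comp_idr : forall f, acomp f (idm (dom f)) = f;
  compA : forall h g f, cod f = dom g -> cod g = dom h ->
    acomp h (acomp g f) = acomp (acomp h g) f;

  one : ob;
  otens : ob -> ob -> ob;
  otensA : associative otens;
  otens1l : left_id one otens;
  otens1r : right_id one otens;
  tens : arr -> arr -> arr;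
  tensA : associative tens;
  tens1l : left_id (idm one) tens;
  tens1r : right_id (idm one) tens;
  dom_tens : forall f g, dom (tens f g) = otens (dom f) (dom g);
  cod_tens : forall f g, cod (tens f g) = otens (cod f) (cod g);
  tens_idm : forall A B, tens (idm A) (idm B) = idm (otens A B);
  tens_comp : forall g f g' f', cod f = dom g -> cod f' = dom g' ->
    tens (acomp g f) (acomp g' f') = acomp (tens g g') (tens f f');

  dag : arr -> arr;
  dom_dag : forall f, dom (dag f) = cod f;
  cod_dag : forall f, cod (dag f) = dom f;
  dagK : involutive dag;
  dag_idm : forall A, dag (idm A) = idm A;
  dag_comp : forall g f, cod f = dom g -> dag (acomp g f) = acomp (dag f) (dag g);
  dag_tens : forall f g, dag (tens f g) = tens (dag f) (dag g)
}.

Bind Scope ob_scope with ob.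
Bind Scope arr_scope with arr.
Arguments one {_}.

Notation "1" := one : ob_scope.
Notation "A ⊗ B" := (otens A%ob B%ob) (at level 40, left associativity) : ob_scope.
Notation "f ⊗ g" := (tens f%arr g%arr) (at level 40, left associativity) : arr_scope.
Notation "g ∘ f" := (acomp g%arr f%arr) (at level 50, left associativity) : arr_scope.
Notation "f †" := (dag f%arr) (at level 2, left associativity, format "f †") : arr_scope.

Definition is_hom (C : strict_monoidal_dagger_category) (A B : ob C) (f : arr C) :=
  dom f = A /\ cod f = B.

Notation "f '∈Hom(' A , B ')'" := (is_hom A%ob B%ob f%arr)
  (at level 70, A at level 69, B at level 69) : type_scope.

Local Open Scope arr_scope.

(* A' plays the role of A^*. *)
Record dagger_duality (C : strict_monoidal_dagger_category) (A A' : ob C) :=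
  DaggerDuality {
    eta : arr C;
    eps : arr C;
    eta_hom : eta ∈Hom(1, A' ⊗ A);
    eps_hom : eps ∈Hom(A ⊗ A', 1);
    snake_l : (eps ⊗ idm A) ∘ (idm A ⊗ eta) = idm A;
    snake_r : (idm A' ⊗ eps) ∘ (eta ⊗ idm A') = idm A'
  }.

Section DaggerDuals.
Variables (C : strict_monoidal_dagger_category) (A A' : ob C).
Variable D : dagger_duality A A'.

Definition eta' : arr C := (eps D)†.
Definition eps' : arr C := (eta D)†.

Local Notation η := (eta D).
Local Notation η' := eta'.

Definition conj_state (u : arr C) : arr C := (u† ⊗ idm A') ∘ η'.

(* The state u† may be bent into A' through η' (this is [conj_state u]) or through η.
   The axioms of a dagger duality do not force the results to agree: take the
   complex numbers as a one-object category, A = A' = 1, η = 1/2, ε = 2.  There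
   u = 1, m = 1/2 is a unital 3-structure, but the associated multiplication 1
   is not symmetric.  Units of symmetric 2-structures always satisfy the
   following condition. *)
Definition conj_unambiguous (u : arr C) : Prop :=
  (u† ⊗ idm A') ∘ η' = (idm A' ⊗ u†) ∘ η.

Record dagger_frobenius2 (μ u : arr C) : Prop := DaggerFrobenius2 {
  mul_hom : μ ∈Hom(A ⊗ A, A);
  unit_hom : u ∈Hom(1, A);
  mul_assoc : μ ∘ (μ ⊗ idm A) = μ ∘ (idm A ⊗ μ);
  mul_unitl : μ ∘ (u ⊗ idm A) = idm A;
  mul_unitr : μ ∘ (idm A ⊗ u) = idm A;
  mul_frobenius :
    (μ ⊗ idm A) ∘ (idm A ⊗ μ†) = (idm A ⊗ μ) ∘ (μ† ⊗ idm A)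
}.

Definition special (μ : arr C) : Prop := μ ∘ μ† = idm A.

Definition invol (μ u : arr C) : arr C :=
  ((u† ∘ μ) ⊗ idm A') ∘ (idm A ⊗ η').

Definition symmetric2 (μ u : arr C) : Prop :=
  invol μ u = (idm A' ⊗ (u† ∘ μ)) ∘ (η ⊗ idm A).

Definition symmetric_dagger_frobenius2 (μ u : arr C) : Prop :=
  dagger_frobenius2 μ u /\ symmetric2 μ u.

Record dagger_frobenius3 (m : arr C) : Prop := DaggerFrobenius3 {
  tri_hom : m ∈Hom(A ⊗ A' ⊗ A, A);
  tri_assoc : m ∘ (idm A ⊗ idm A' ⊗ m) = m ∘ (m ⊗ idm A' ⊗ idm A);
  tri_frobenius_l :
    (m ⊗ idm A' ⊗ idm A) ∘ (idm A ⊗ idm A' ⊗ η' ⊗ idm A) ∘ (idm A ⊗ η) = m†;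
  tri_frobenius_r :
    m† = (idm A ⊗ idm A' ⊗ m) ∘ (idm A ⊗ η ⊗ idm A' ⊗ idm A) ∘ (η' ⊗ idm A)
}.

Record unital3 (m u : arr C) : Prop := Unital3 {
  tri_unit_hom : u ∈Hom(1, A);
  tri_unitl : m ∘ (u ⊗ conj_state u ⊗ idm A) = idm A;
  tri_unitr : m ∘ (idm A ⊗ conj_state u ⊗ u) = idm A
}.

Definition unital_dagger_frobenius3 (m u : arr C) : Prop :=
  dagger_frobenius3 m /\ unital3 m u.

Definition normal3 (m : arr C) : Prop :=
  m ∘ (η' ⊗ idm A) = idm A /\ m ∘ (idm A ⊗ η) = idm A.

Definition lmap (m : arr C) : arr C := (idm A' ⊗ m) ∘ (η ⊗ idm A' ⊗ idm A).
Definition rmap (m : arr C) : arr C := (m ⊗ idm A') ∘ (idm A ⊗ idm A' ⊗ η').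

Definition left_idempotent (m : arr C) : Prop := lmap m ∘ lmap m = lmap m.
Definition right_idempotent (m : arr C) : Prop := rmap m ∘ rmap m = rmap m.

Definition frob3_of (μ u : arr C) : arr C :=
  μ ∘ (μ ⊗ idm A) ∘ (idm A ⊗ (invol μ u)† ⊗ idm A).

Definition frob2_of (m u : arr C) : arr C :=
  m ∘ (idm A ⊗ conj_state u ⊗ idm A).

End DaggerDuals.

(* Main.v *)
Require Import Defs.
From mathcomp Require Import ssreflect ssrfun ssrbool ssrnat eqtype seq.

(* Let γ = μ† ∘ u.  The form u† ∘ μ and γ satisfy the snake equations, so symmetry
   gives j† ∘ j = id for the involution j, and
   η' = (id ⊗ j) ∘ γ, η = (j ⊗ id) ∘ γ, u_* = j ∘ u.  Hence m is the ternary product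
   with its middle argument transported along j†, and each axiom of m is an identity
   between iterated products.  Conversely, for a unital 3-structure the dagger of
   the involution of the induced product is y ↦ m(u, y, u), and associativity of m
   with the unit laws recovers m.  Both m ∘ (η' ⊗ id) and m ∘ (id ⊗ η) equal
   μ ∘ μ†, whence special = normal; and composing [lmap m] or [rmap m] with itself
   inserts μ ∘ μ† into an outer argument of m, where it can be isolated by
   uncurrying and plugging units into the other two arguments.

   Planar isotopies of string diagrams are proved by reflection: a diagram is a list
   of slices, normalized by the interchange law. *)

Set Implicit Arguments.
Unset Strict Implicit.
Unset Printing Implicit Defensive.

(** * String diagrams and their normal form under interchange *)

Section Diagrams.
Variable C : strict_monoidal_dagger_category.
Local Open Scope arr_scope.
Implicit Types (X Y Z : ob C) (f g h : arr C) (v w : seq (ob C)).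

Lemma comp_hom X Y Z f g : f ∈Hom(X, Y) -> g ∈Hom(Y, Z) -> g ∘ f ∈Hom(X, Z).
Proof. by move=> [<- fY] [gY <-]; split; rewrite (dom_comp, cod_comp) ?fY. Qed.

Lemma tens_hom X Y X' Y' f g :
  f ∈Hom(X, Y) -> g ∈Hom(X', Y') -> f ⊗ g ∈Hom(X ⊗ X', Y ⊗ Y').
Proof. by move=> [<- <-] [<- <-]; split; rewrite (dom_tens, cod_tens). Qed.

Lemma idm_hom X : idm X ∈Hom(X, X).
Proof. by split; rewrite (dom_idm, cod_idm). Qed.

Lemma dag_hom X Y f : f ∈Hom(X, Y) -> f† ∈Hom(Y, X).
Proof. by move=> [<- <-]; split; rewrite (dom_dag, cod_dag). Qed.

Lemma comp_hom_idl X Y f : f ∈Hom(X, Y) -> idm Y ∘ f = f.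
Proof. by case=> _ <-; rewrite comp_idl. Qed.

Lemma comp_hom_idr X Y f : f ∈Hom(X, Y) -> f ∘ idm X = f.
Proof. by case=> <- _; rewrite comp_idr. Qed.

Lemma comp_homA W X Y Z f g h : f ∈Hom(W, X) -> g ∈Hom(X, Y) -> h ∈Hom(Y, Z) ->
  h ∘ (g ∘ f) = h ∘ g ∘ f.
Proof. by move=> [_ fX] [gX gY] [hY _]; rewrite Defs.compA ?fX ?gY. Qed.

Lemma tens_hom_comp X Y Z X' Y' Z' f g f' g' :
  f ∈Hom(X, Y) -> g ∈Hom(Y, Z) -> f' ∈Hom(X', Y') -> g' ∈Hom(Y', Z') ->
  (g ⊗ g') ∘ (f ⊗ f') = (g ∘ f) ⊗ (g' ∘ f').
Proof.
by move=> [_ fY] [gY _] [_ fY'] [gY' _]; rewrite tens_comp ?fY ?fY'.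
Qed.

Lemma interchange_l X Y X' Y' f g : f ∈Hom(X, Y) -> g ∈Hom(X', Y') ->
  (f ⊗ idm Y') ∘ (idm X ⊗ g) = f ⊗ g.
Proof.
move=> fH gH; rewrite (tens_hom_comp (idm_hom X) fH gH (idm_hom Y')).
by rewrite (comp_hom_idr fH) (comp_hom_idl gH).
Qed.

Lemma interchange_r X Y X' Y' f g : f ∈Hom(X, Y) -> g ∈Hom(X', Y') ->
  (idm Y ⊗ g) ∘ (f ⊗ idm X') = f ⊗ g.
Proof.
move=> fH gH; rewrite (tens_hom_comp fH (idm_hom Y) (idm_hom X') gH).
by rewrite (comp_hom_idl fH) (comp_hom_idr gH).
Qed.

(** Boundaries are lists of wires, so that regrouping tensor factors and dropping units becomes
    computation on lists. *)
Definition word_ob w : ob C := foldr (@otens C) one w.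

Lemma word_ob_cat v w : word_ob (v ++ w) = (word_ob v ⊗ word_ob w)%ob.
Proof. by elim: v => [|X v IH] /=; rewrite ?otens1l // IH otensA. Qed.

(* The morphism [id ⊗ box ⊗ id]; a string diagram is a list of such slices, the
   first one being applied first. *)
Record slice := Slice {
  lft : seq (ob C); src : seq (ob C); box : arr C; tgt : seq (ob C); rgt : seq (ob C)
}.
Implicit Types (c : slice) (d : seq slice).

Definition slice_dom c := lft c ++ src c ++ rgt c.
Definition slice_cod c := lft c ++ tgt c ++ rgt c.
Definition slice_arr c := idm (word_ob (lft c)) ⊗ box c ⊗ idm (word_ob (rgt c)).
Definition slice_ok c := box c ∈Hom(word_ob (src c), word_ob (tgt c)).

Fixpoint typed w d w' : Prop :=
  if d is c :: d' then [/\ w = slice_dom c, slice_ok c & typed (slice_cod c) d' w']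
  else w = w'.

Fixpoint diagram_arr w d : arr C :=
  if d is c :: d' then diagram_arr (slice_cod c) d' ∘ slice_arr c else idm (word_ob w).

Lemma slice_hom c :
  slice_ok c -> slice_arr c ∈Hom(word_ob (slice_dom c), word_ob (slice_cod c)).
Proof.
move=> cH; rewrite !word_ob_cat !otensA.
by apply: tens_hom (idm_hom _); apply: tens_hom (idm_hom _) cH.
Qed.

Lemma diagram_hom w d w' :
  typed w d w' -> diagram_arr w d ∈Hom(word_ob w, word_ob w').
Proof.
elim: d w => [|c d IH] w /=; first by move=> ->; apply: idm_hom.
by case=> -> /slice_hom cH /IH; apply: comp_hom cH.
Qed.

Lemma typed_cat w d w1 e w2 :
  typed w d w1 -> typed w1 e w2 -> typed w (d ++ e) w2.
Proof. by elim: d w => [|c d IH] w /=; [move=> -> | case=> -> cH /IH dH /dH]. Qed.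

Lemma diagram_cat w d w1 e w2 : typed w d w1 -> typed w1 e w2 ->
  diagram_arr w (d ++ e) = diagram_arr w1 e ∘ diagram_arr w d.
Proof.
elim: d w => [|c d IH] w /=.
  by move=> -> eH; rewrite (comp_hom_idr (diagram_hom eH)).
case=> wE cH dH eH; rewrite (IH _ dH eH).
by rewrite (comp_homA (slice_hom cH) (diagram_hom dH) (diagram_hom eH)).
Qed.

Definition whiskerl v c := Slice (v ++ lft c) (src c) (box c) (tgt c) (rgt c).
Definition whiskerr v c := Slice (lft c) (src c) (box c) (tgt c) (rgt c ++ v).

Lemma typed_whiskerl v w d w' :
  typed w d w' -> typed (v ++ w) (map (whiskerl v) d) (v ++ w').
Proof.
elim: d w => [|c d IH] w /=; first by move=> ->.
by case=> -> cH /IH; split=> //; rewrite /slice_dom /slice_cod /= -catA.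
Qed.

Lemma typed_whiskerr v w d w' :
  typed w d w' -> typed (w ++ v) (map (whiskerr v) d) (w' ++ v).
Proof.
elim: d w => [|c d IH] w /=; first by move=> ->.
by case=> -> cH /IH; rewrite /slice_dom /slice_cod /= -!catA.
Qed.

Lemma diagram_whiskerl v w d w' : typed w d w' ->
  diagram_arr (v ++ w) (map (whiskerl v) d) = idm (word_ob v) ⊗ diagram_arr w d.
Proof.
elim: d w => [|c d IH] w /=; first by rewrite word_ob_cat tens_idm.
case=> _ cH dH; rewrite {1}/slice_cod /= -catA (IH _ dH).
rewrite -{2}(comp_hom_idl (idm_hom (word_ob v))).
rewrite -(tens_hom_comp (idm_hom _) (idm_hom _) (slice_hom cH) (diagram_hom dH)).
by rewrite /slice_arr /= word_ob_cat -tens_idm !tensA.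
Qed.

Lemma diagram_whiskerr v w d w' : typed w d w' ->
  diagram_arr (w ++ v) (map (whiskerr v) d) = diagram_arr w d ⊗ idm (word_ob v).
Proof.
elim: d w => [|c d IH] w /=; first by rewrite word_ob_cat tens_idm.
case=> _ cH dH.
have -> : slice_cod (whiskerr v c) = slice_cod c ++ v.
  by rewrite /slice_cod /= -!catA.
rewrite (IH _ dH) -{2}(comp_hom_idl (idm_hom (word_ob v))).
rewrite -(tens_hom_comp (slice_hom cH) (diagram_hom dH) (idm_hom _) (idm_hom _)).
by rewrite /slice_arr /= word_ob_cat -tens_idm !tensA.
Qed.

(* [c2], applied right after [c1], only touches wires to the left of [box c1]. *)
Definition left_of c2 c1 := size (lft c2) + size (src c2) <= size (lft c1).

(** [gap] is the strip of wires between the two boxes. [raise] and [lower] are [c2] and [c1] after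
    the swap, their contexts adjusted to the new order. *)
Definition gap c1 c2 := drop (size (lft c2) + size (src c2)) (lft c1).
Definition raise c1 c2 :=
  Slice (lft c2) (src c2) (box c2) (tgt c2) (gap c1 c2 ++ src c1 ++ rgt c1).
Definition lower c1 c2 :=
  Slice (lft c2 ++ tgt c2 ++ gap c1 c2) (src c1) (box c1) (tgt c1) (rgt c1).

(** The level between the two slices has two descriptions; both are cut just after the inputs of
    [c2]. *)
Lemma left_ofP c1 c2 : left_of c2 c1 -> slice_cod c1 = slice_dom c2 ->
  lft c1 = lft c2 ++ src c2 ++ gap c1 c2 /\ rgt c2 = gap c1 c2 ++ tgt c1 ++ rgt c1.
Proof.
rewrite /left_of /gap /slice_cod /slice_dom -size_cat => le21.
set n := size _ in le21 *; move=> E.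
have E' : take n (lft c1) ++ drop n (lft c1) ++ tgt c1 ++ rgt c1
        = (lft c2 ++ src c2) ++ rgt c2 by rewrite catA cat_take_drop -catA.
have takeE : take n (lft c1) = lft c2 ++ src c2.
  by move/(congr1 (take n)): E'; rewrite !take_size_cat ?size_takel.
have := congr1 (drop n) E'; rewrite !drop_size_cat ?size_takel // => <-.
by rewrite catA -takeE cat_take_drop.
Qed.

Lemma interchange c1 c2 : left_of c2 c1 -> slice_cod c1 = slice_dom c2 ->
  slice_ok c1 -> slice_ok c2 ->
  [/\ slice_dom (raise c1 c2) = slice_dom c1,
      slice_cod (raise c1 c2) = slice_dom (lower c1 c2),
      slice_cod (lower c1 c2) = slice_cod c2 &
      slice_arr (lower c1 c2) ∘ slice_arr (raise c1 c2) = slice_arr c2 ∘ slice_arr c1].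
Proof.
move=> c21 c12 ok1 ok2; have [l1E r2E] := left_ofP c21 c12.
move: (gap c1 c2) l1E r2E => m l1E r2E.
have mE: gap c1 c2 = m.
  by rewrite /gap l1E -size_cat catA drop_size_cat.
rewrite /slice_dom /slice_cod /slice_arr /= mE.
case: c1 c2 l1E r2E ok1 ok2 {c21 c12 mE} =>
  [l1 s1 f1 t1 r1] [l2 s2 f2 t2 r2] /= -> -> ok1 ok2.
rewrite -!catA; split=> //.
rewrite !word_ob_cat -!tens_idm.
set L := word_ob l2; set M := word_ob m; set R := word_ob r1.
(* [F2] takes the left context and the gap, [F1] the right context; both orders of composition then
   equal [F2 ⊗ F1]. *)
pose F2 := idm L ⊗ f2 ⊗ idm M; pose F1 := f1 ⊗ idm R.
have H2 : F2 ∈Hom(L ⊗ word_ob s2 ⊗ M, L ⊗ word_ob t2 ⊗ M).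
  by apply: tens_hom (idm_hom _); apply: tens_hom (idm_hom _) ok2.
have H1 : F1 ∈Hom(word_ob s1 ⊗ R, word_ob t1 ⊗ R) by apply: tens_hom (idm_hom _).
have := interchange_l H2 H1; rewrite -(interchange_r H2 H1).
by rewrite /F1 /F2 -!tens_idm !tensA => ->.
Qed.

(* Bubbling the leftmost boxes to the front.  Only the soundness of the resulting
   normal form is proved; the number of passes is a generous guess. *)
Fixpoint sink c d :=
  if d is c' :: d' then
    if left_of c' c then raise c c' :: sink (lower c c') d' else c :: sink c' d'
  else [:: c].

Definition pass d := if d is c :: d' then sink c d' else [::].
Definition normalize d := iter (size d * size d) pass d.

Lemma sinkP w c d w' : typed w (c :: d) w' ->
  typed w (sink c d) w' /\ diagram_arr w (sink c d) = diagram_arr w (c :: d).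
Proof.
elim: d w c => [|c' d IH] w c //=.
case=> wE cH [cc' cH' dH]; case: ifP => [c'c|_] /=; last first.
  by case: (IH (slice_cod c) c') => //= tH ->.
have [domE codE cod2E arrE] := interchange c'c cc' cH cH'.
have tH : typed (slice_cod (raise c c')) (lower c c' :: d) w'.
  by split=> //; rewrite cod2E.
have [{}tH ->] := IH _ _ tH; split; first by split=> //; rewrite domE.
have rH := slice_hom (c := raise c c') cH'; rewrite codE in rH.
have lH := slice_hom (c := lower c c') cH; rewrite cod2E in lH.
have sH := slice_hom cH; rewrite cc' in sH.
rewrite /= cod2E -(comp_homA rH lH (diagram_hom dH)) arrE.
by rewrite (comp_homA sH (slice_hom cH') (diagram_hom dH)).
Qed.

Lemma normalizeP w d w' : typed w d w' ->
  typed w (normalize d) w' /\ diagram_arr w (normalize d) = diagram_arr w d.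
Proof.
rewrite /normalize; elim: (_ * _)%N => //= n IH /IH [].
by case: (iter n pass d) => [|c e] //= /sinkP[tH ->].
Qed.

(** * Reification of arrows as diagrams *)

Definition spells w X := word_ob w = X.
(** Kept as a relation so that proof search along the term [f] can synthesize the boundaries and the
    diagram as existential variables. *)
Definition draws f w d w' := typed w d w' /\ diagram_arr w d = f.

Lemma spells_tens v w X Y : spells v X -> spells w Y -> spells (v ++ w) (X ⊗ Y).
Proof. by rewrite /spells word_ob_cat => -> ->. Qed.

Lemma spells_one : spells [::] one. Proof. by []. Qed.

Lemma spells_atom X : spells [:: X] X. Proof. exact: otens1r. Qed.

Lemma draws_comp f g v d w w' e v' :
  draws f v d w -> draws g w' e v' -> w = w' -> draws (g ∘ f) v (d ++ e) v'.
Proof.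
move=> [dH <-] [eH <-] ww'; rewrite -ww' in eH *.
by split; [apply: typed_cat dH eH | rewrite (diagram_cat dH eH)].
Qed.

(** All of [f] is drawn before [g]; the choice is arbitrary and is left to normalization. *)
Lemma draws_tens f g v d w v' e w' : draws f v d w -> draws g v' e w' ->
  draws (f ⊗ g) (v ++ v') (map (whiskerr v') d ++ map (whiskerl w) e) (w ++ w').
Proof.
move=> [dH <-] [eH <-].
have [dH' eH'] := (typed_whiskerr v' dH, typed_whiskerl w eH).
split; first exact: typed_cat dH' eH'.
rewrite (diagram_cat dH' eH') (diagram_whiskerl _ eH) (diagram_whiskerr _ dH).
exact: interchange_r (diagram_hom dH) (diagram_hom eH).
Qed.

Lemma draws_idm X w : spells w X -> draws (idm X) w [::] w.
Proof. by move=> <-. Qed.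

Lemma draws_box f X Y v w : f ∈Hom(X, Y) -> spells v X -> spells w Y ->
  draws f v [:: Slice [::] v f w [::]] w.
Proof.
move=> fH vX wY; split.
  by rewrite /= /slice_dom /slice_cod /slice_ok /= !cats0 vX wY.
rewrite /= /slice_arr /slice_cod /= cats0 tens1l tens1r wY.
exact: comp_hom_idl fH.
Qed.

Lemma planar_eq f g v d w v' e w' : draws f v d w -> draws g v' e w' ->
  v = v' -> normalize d = normalize e -> f = g.
Proof.
move=> [dH <-] [eH <-] vv' de; rewrite -vv' in eH *.
by rewrite -(normalizeP dH).2 -(normalizeP eH).2 de.
Qed.

Lemma draws_hom f v d w X Y v' w' : draws f v d w ->
  spells v' X -> spells w' Y -> v = v' -> w = w' -> f ∈Hom(X, Y).
Proof. by move=> [dH <-] <- <- <- <-; apply: diagram_hom. Qed.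

(** The composability condition of [dag_comp] is read off the two drawings. *)
Lemma draws_dag_comp f g v d w w' e v' :
  draws f v d w -> draws g w' e v' -> w = w' -> (g ∘ f)† = f† ∘ g†.
Proof.
move=> [/diagram_hom dH <-] [/diagram_hom eH <-] ww'; rewrite -ww' in eH *.
by rewrite dag_comp // dH.2 eH.1.
Qed.

Lemma dag_inj f g : f† = g† -> f = g.
Proof. by move=> /(congr1 (@dag C)); rewrite !dagK. Qed.

End Diagrams.

(* Tactics for typing, planar isotopy and daggers *)
Create HintDb hom.
#[local] Hint Resolve dag_hom : hom.

Ltac spell :=
  lazymatch goal with
  | |- spells _ (otens _ _) => eapply spells_tens; spell
  | |- spells _ one => apply spells_one
  | |- _ => apply spells_atom
  end.

Ltac draw :=
  lazymatch goal with
  | |- draws (acomp _ _) _ _ _ => eapply draws_comp; [draw | draw | reflexivity]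
  | |- draws (tens _ _) _ _ _ => eapply draws_tens; draw
  | |- draws (idm _) _ _ _ => eapply draws_idm; spell
  | |- _ => eapply draws_box; [solve [eauto with hom] | spell | spell]
  end.

Ltac hom := eapply draws_hom; [draw | spell | spell | reflexivity | reflexivity].

Ltac push_dag :=
  repeat first [ rewrite dag_tens | rewrite dag_idm | rewrite dagK
               | erewrite draws_dag_comp; [| draw | draw | reflexivity] ].

Ltac planar := eapply planar_eq; [draw | draw | reflexivity | reflexivity].

(* Redraws the left-hand side so that the next rewrite finds its redex as a subterm. *)
Tactic Notation "via" constr(f) := transitivity f; first planar.

(** * Dagger duality and its snake equations *)

Section Correspondence.
Variables (C : strict_monoidal_dagger_category) (A A' : ob C).
Variable D : dagger_duality A A'.
Local Open Scope arr_scope.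

Local Notation η := (eta D).
Local Notation ε := (eps D).
Local Notation η' := (eta' D).
Local Notation ε' := (eps' D).
Local Notation a := (idm A).
Local Notation a' := (idm A').

Lemma eta'_hom : η' ∈Hom(1, A ⊗ A').
Proof. exact/dag_hom/eps_hom. Qed.

Lemma eps'_hom : ε' ∈Hom(A' ⊗ A, 1).
Proof. exact/dag_hom/eta_hom. Qed.

#[local] Hint Resolve eta_hom eps_hom eta'_hom eps'_hom : hom.

Lemma snake_l' : (a ⊗ ε') ∘ (η' ⊗ a) = a.
Proof. by apply: dag_inj; push_dag; rewrite snake_l. Qed.

Lemma snake_r' : (ε' ⊗ a') ∘ (a' ⊗ η') = a'.
Proof. by apply: dag_inj; push_dag; rewrite snake_r. Qed.

Lemma conj_state_hom u : u ∈Hom(1, A) -> conj_state D u ∈Hom(1, A').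
Proof. move=> u_hom; rewrite /conj_state; hom. Qed.

(** * From symmetric 2-structures to unital 3-structures *)

Section FromTwo.
Variables μ u : arr C.
Hypothesis frob : dagger_frobenius2 A μ u.
Hypothesis sym : symmetric2 D μ u.

Local Notation β := (u† ∘ μ).
Local Notation γ := (μ† ∘ u).
Local Notation j := (invol D μ u).
Local Notation m := (frob3_of D μ u).

Let μ_hom : μ ∈Hom(A ⊗ A, A) := mul_hom frob.
Let u_hom : u ∈Hom(1, A) := unit_hom frob.
#[local] Hint Resolve μ_hom u_hom conj_state_hom : hom.

Lemma counitl : (u† ⊗ a) ∘ μ† = a.
Proof. by apply: dag_inj; push_dag; rewrite (mul_unitl frob). Qed.

Lemma counitr : (a ⊗ u†) ∘ μ† = a.
Proof. by apply: dag_inj; push_dag; rewrite (mul_unitr frob). Qed.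

(** This is the Frobenius law with a unit plugged into its second input; the unit law then removes
    the remaining [μ]. *)
Lemma comul_cupl : (μ ⊗ a) ∘ (a ⊗ γ) = μ†.
Proof.
via (((μ ⊗ a) ∘ (a ⊗ μ†)) ∘ (a ⊗ u)); rewrite (mul_frobenius frob).
via ((a ⊗ (μ ∘ (a ⊗ u))) ∘ μ†); rewrite (mul_unitr frob); planar.
Qed.

Lemma comul_cupr : (a ⊗ μ) ∘ (γ ⊗ a) = μ†.
Proof.
via (((a ⊗ μ) ∘ (μ† ⊗ a)) ∘ (u ⊗ a)); rewrite -(mul_frobenius frob).
via (((μ ∘ (u ⊗ a)) ⊗ a) ∘ μ†); rewrite (mul_unitl frob); planar.
Qed.

Lemma form_snakel : (β ⊗ a) ∘ (a ⊗ γ) = a.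
Proof. by via ((u† ⊗ a) ∘ ((μ ⊗ a) ∘ (a ⊗ γ))); rewrite comul_cupl counitl. Qed.

Lemma form_snaker : (a ⊗ β) ∘ (γ ⊗ a) = a.
Proof. by via ((a ⊗ u†) ∘ ((a ⊗ μ) ∘ (γ ⊗ a))); rewrite comul_cupr counitr. Qed.

Lemma invol_hom : j ∈Hom(A, A').
Proof. rewrite /invol; hom. Qed.

#[local] Hint Resolve invol_hom : hom.

Lemma dag_invol : j† = (a ⊗ ε) ∘ (γ ⊗ a').
Proof. by rewrite /invol; push_dag. Qed.

Lemma dag_involK : j† ∘ j = a.
Proof.
(* Symmetry supplies the form of [j] built from η, which meets the ε of [j†] in a snake. *)
rewrite dag_invol sym.
via ((a ⊗ β) ∘ (a ⊗ ((ε ⊗ a) ∘ (a ⊗ η)) ⊗ a) ∘ (γ ⊗ a)); rewrite snake_l.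
via ((a ⊗ β) ∘ (γ ⊗ a)); exact: form_snaker.
Qed.

Lemma cup_invol_r : (a ⊗ j) ∘ γ = η'.
Proof.
rewrite /invol.
via (((a ⊗ β) ∘ (γ ⊗ a)) ⊗ a' ∘ η'); rewrite form_snaker; planar.
Qed.

Lemma cup_invol_l : (j ⊗ a) ∘ γ = η.
Proof.
rewrite sym.
via ((a' ⊗ ((β ⊗ a) ∘ (a ⊗ γ))) ∘ η); rewrite form_snakel; planar.
Qed.

Lemma invol_unit_l : j ∘ u = conj_state D u.
Proof.
rewrite /invol /conj_state.
via (((u† ∘ (μ ∘ (u ⊗ a))) ⊗ a') ∘ η'); rewrite (mul_unitl frob); planar.
Qed.

Lemma invol_unit_r : j ∘ u = (a' ⊗ u†) ∘ η.
Proof.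
rewrite sym.
via ((a' ⊗ (u† ∘ (μ ∘ (a ⊗ u)))) ∘ η); rewrite (mul_unitr frob); planar.
Qed.

(** The two expressions for [j], evaluated at the unit, are the two ways of bending [u†]. *)
Lemma conj_unambiguous_unit : conj_unambiguous D u.
Proof. by rewrite /conj_unambiguous -invol_unit_r invol_unit_l. Qed.

Lemma dag_invol_conj : j† ∘ conj_state D u = u.
Proof.
rewrite -invol_unit_l; via (j† ∘ j ∘ u); rewrite dag_involK; planar.
Qed.

Lemma frob3_of_hom : m ∈Hom(A ⊗ A' ⊗ A, A).
Proof. rewrite /frob3_of; hom. Qed.

#[local] Hint Resolve frob3_of_hom : hom.

(** Associativity in the left-nested shape produced by [frob3_of]; two uses reassociate the five
    inputs of a composite of two copies of [m]. *)
Lemma mul4A : μ ∘ (μ ⊗ a) ∘ (a ⊗ a ⊗ μ) = μ ∘ (μ ⊗ a) ∘ (μ ⊗ a ⊗ a).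
Proof.
via ((μ ∘ (a ⊗ μ)) ∘ (μ ⊗ a ⊗ a)); rewrite -(mul_assoc frob); planar.
Qed.

Lemma frob3_of_assoc : m ∘ (a ⊗ a' ⊗ m) = m ∘ (m ⊗ a' ⊗ a).
Proof.
rewrite /frob3_of.
via (μ ∘ (μ ⊗ a) ∘ (a ⊗ a ⊗ μ) ∘ (a ⊗ a ⊗ μ ⊗ a) ∘ (a ⊗ j† ⊗ a ⊗ j† ⊗ a)).
rewrite mul4A.
via (μ ∘ ((μ ∘ (μ ⊗ a) ∘ (a ⊗ a ⊗ μ)) ⊗ a) ∘ (a ⊗ j† ⊗ a ⊗ j† ⊗ a)).
rewrite mul4A; planar.
Qed.

Lemma dag_frob3_of : m† = (a ⊗ j ⊗ a) ∘ ((μ† ⊗ a) ∘ μ†).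
Proof. by rewrite /frob3_of; push_dag. Qed.

Lemma comulA : (a ⊗ μ†) ∘ μ† = (μ† ⊗ a) ∘ μ†.
Proof. by apply: dag_inj; push_dag; rewrite (mul_assoc frob). Qed.

(** Once η and η' are written through γ, a [j] enters the middle input of [m] and cancels [j†]
    there. *)
Lemma frob3_of_invol : m ∘ (a ⊗ j ⊗ a) = μ ∘ (μ ⊗ a).
Proof.
rewrite /frob3_of; via (μ ∘ (μ ⊗ a) ∘ (a ⊗ (j† ∘ j) ⊗ a)).
rewrite dag_involK; planar.
Qed.

Lemma frob3_of_frobenius_l :
  (m ⊗ a' ⊗ a) ∘ (a ⊗ a' ⊗ η' ⊗ a) ∘ (a ⊗ η) = m†.
Proof.
(* The [j] coming from η is absorbed by [m]; the one coming from η' survives as the middle output of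
   [m†]. *)
rewrite dag_frob3_of -cup_invol_r -cup_invol_l.
via ((a ⊗ j ⊗ a) ∘ ((m ∘ (a ⊗ j ⊗ a)) ⊗ a ⊗ a) ∘ (a ⊗ a ⊗ γ ⊗ a) ∘ (a ⊗ γ)).
rewrite frob3_of_invol.
via ((a ⊗ j ⊗ a) ∘ ((((μ ⊗ a) ∘ (a ⊗ γ)) ⊗ a) ∘ ((μ ⊗ a) ∘ (a ⊗ γ)))).
by rewrite comul_cupl.
Qed.

Lemma frob3_of_frobenius_r :
  m† = (a ⊗ a' ⊗ m) ∘ (a ⊗ η ⊗ a' ⊗ a) ∘ (η' ⊗ a).
Proof.
rewrite dag_frob3_of -cup_invol_r -cup_invol_l -comulA; symmetry.
via ((a ⊗ j ⊗ a) ∘ (a ⊗ a ⊗ (m ∘ (a ⊗ j ⊗ a))) ∘ (a ⊗ γ ⊗ a ⊗ a) ∘ (γ ⊗ a)).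
rewrite frob3_of_invol (mul_assoc frob).
via ((a ⊗ j ⊗ a) ∘ ((a ⊗ ((a ⊗ μ) ∘ (γ ⊗ a))) ∘ ((a ⊗ μ) ∘ (γ ⊗ a)))).
by rewrite comul_cupr.
Qed.

Lemma frob3_of_unit_l : m ∘ (u ⊗ conj_state D u ⊗ a) = a.
Proof.
rewrite /frob3_of.
via (μ ∘ ((μ ∘ (u ⊗ a)) ⊗ a) ∘ ((j† ∘ conj_state D u) ⊗ a)).
rewrite dag_invol_conj (mul_unitl frob).
via (μ ∘ (u ⊗ a)); exact: mul_unitl frob.
Qed.

Lemma frob3_of_unit_r : m ∘ (a ⊗ conj_state D u ⊗ u) = a.
Proof.
rewrite /frob3_of.
via ((μ ∘ (a ⊗ u)) ∘ μ ∘ (a ⊗ (j† ∘ conj_state D u))).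
rewrite dag_invol_conj (mul_unitr frob).
via (μ ∘ (a ⊗ u)); exact: mul_unitr frob.
Qed.

Lemma frob3_ofP : unital_dagger_frobenius3 D m u.
Proof.
split; split; rewrite ?frob3_of_frobenius_l //.
- exact: frob3_of_hom.
- exact: frob3_of_assoc.
- exact: frob3_of_frobenius_r.
- exact: frob3_of_unit_l.
- exact: frob3_of_unit_r.
Qed.

Lemma frob3_ofK : frob2_of D m u = μ.
Proof.
rewrite /frob2_of /frob3_of.
via (μ ∘ ((μ ∘ (a ⊗ (j† ∘ conj_state D u))) ⊗ a)).
rewrite dag_invol_conj (mul_unitr frob); planar.
Qed.

(** * Speciality, normality and idempotency *)

Lemma frob3_of_eta' : m ∘ (η' ⊗ a) = μ ∘ μ†.
Proof.
rewrite -cup_invol_r.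
via (m ∘ (a ⊗ j ⊗ a) ∘ (γ ⊗ a)); rewrite frob3_of_invol (mul_assoc frob).
via (μ ∘ ((a ⊗ μ) ∘ (γ ⊗ a))); by rewrite comul_cupr.
Qed.

Lemma frob3_of_eta : m ∘ (a ⊗ η) = μ ∘ μ†.
Proof.
rewrite -cup_invol_l.
via (m ∘ (a ⊗ j ⊗ a) ∘ (a ⊗ γ)); rewrite frob3_of_invol.
via (μ ∘ ((μ ⊗ a) ∘ (a ⊗ γ))); by rewrite comul_cupl.
Qed.

Lemma special_normal : special A μ <-> normal3 D m.
Proof.
by rewrite /special /normal3 frob3_of_eta frob3_of_eta'; split=> [-> | []].
Qed.

(** Associativity regroups the two copies of [m] so that one cup fills the last two inputs of the
    inner copy, as in [frob3_of_eta]. *)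
Lemma lmap_comp : lmap D m ∘ lmap D m = lmap D (m ∘ ((μ ∘ μ†) ⊗ a' ⊗ a)).
Proof.
rewrite -frob3_of_eta /lmap.
via ((a' ⊗ (m ∘ (a ⊗ a' ⊗ m))) ∘ (η ⊗ η ⊗ a' ⊗ a)).
rewrite frob3_of_assoc; planar.
Qed.

Lemma rmap_comp : rmap D m ∘ rmap D m = rmap D (m ∘ (a ⊗ a' ⊗ (μ ∘ μ†))).
Proof.
rewrite -frob3_of_eta' /rmap.
via (((m ∘ (m ⊗ a' ⊗ a)) ⊗ a') ∘ (a ⊗ a' ⊗ η' ⊗ η')).
rewrite -frob3_of_assoc; planar.
Qed.

(** Uncurrying makes [lmap] injective, so an equation between left maps descends to the ternary
    operations. *)
Lemma lmapK f : f ∈Hom(A ⊗ A' ⊗ A, A) ->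
  (ε ⊗ a) ∘ (a ⊗ lmap D f) = f.
Proof.
move=> f_hom; rewrite /lmap.
via (f ∘ (((ε ⊗ a) ∘ (a ⊗ η)) ⊗ a' ⊗ a)); rewrite snake_l; planar.
Qed.

Lemma rmapK f : f ∈Hom(A ⊗ A' ⊗ A, A) ->
  (a ⊗ ε') ∘ (rmap D f ⊗ a) = f.
Proof.
move=> f_hom; rewrite /rmap.
via (f ∘ (a ⊗ a' ⊗ ((a ⊗ ε') ∘ (η' ⊗ a)))); rewrite snake_l'; planar.
Qed.

Lemma special_left_idempotent : special A μ <-> left_idempotent D m.
Proof.
rewrite /special /left_idempotent lmap_comp; split=> [-> | idem].
  by congr lmap; planar.
have absorb : m ∘ ((μ ∘ μ†) ⊗ a' ⊗ a) = m.
  by rewrite -[LHS]lmapK ?idem ?lmapK; auto with hom; hom.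
transitivity (m ∘ (a ⊗ conj_state D u ⊗ u) ∘ (μ ∘ μ†)).
  rewrite frob3_of_unit_r; planar.
via (m ∘ ((μ ∘ μ†) ⊗ a' ⊗ a) ∘ (a ⊗ conj_state D u ⊗ u)).
rewrite absorb; exact: frob3_of_unit_r.
Qed.

Lemma special_right_idempotent : special A μ <-> right_idempotent D m.
Proof.
rewrite /special /right_idempotent rmap_comp; split=> [-> | idem].
  by congr rmap; planar.
have absorb : m ∘ (a ⊗ a' ⊗ (μ ∘ μ†)) = m.
  by rewrite -[LHS]rmapK ?idem ?rmapK; auto with hom; hom.
transitivity (m ∘ (u ⊗ conj_state D u ⊗ a) ∘ (μ ∘ μ†)).
  rewrite frob3_of_unit_l; planar.
via (m ∘ (a ⊗ a' ⊗ (μ ∘ μ†)) ∘ (u ⊗ conj_state D u ⊗ a)).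
rewrite absorb; exact: frob3_of_unit_l.
Qed.

End FromTwo.

(** * From unital 3-structures back to symmetric 2-structures *)

Section FromThree.
Variables m u : arr C.
Hypothesis frob : unital_dagger_frobenius3 D m u.
Hypothesis unambiguous : conj_unambiguous D u.

Local Notation s := (conj_state D u).
Local Notation μ := (frob2_of D m u).
Local Notation t := (m ∘ (u ⊗ a' ⊗ u)).

Let m_hom : m ∈Hom(A ⊗ A' ⊗ A, A) := tri_hom frob.1.
Let u_hom : u ∈Hom(1, A) := tri_unit_hom frob.2.
#[local] Hint Resolve m_hom u_hom conj_state_hom : hom.

Lemma frob2_of_hom : μ ∈Hom(A ⊗ A, A).
Proof. rewrite /frob2_of; hom. Qed.

#[local] Hint Resolve frob2_of_hom : hom.

(** Straightening against η' requires [s] to be bent through η; this is where [conj_unambiguous]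
    enters. *)
Lemma conj_state_eta' : (a ⊗ s†) ∘ η' = u.
Proof.
rewrite [s]unambiguous; push_dag.
via (((a ⊗ ε') ∘ (η' ⊗ a)) ∘ u); rewrite snake_l'; planar.
Qed.

Lemma conj_state_eta : (s† ⊗ a) ∘ η = u.
Proof.
rewrite /conj_state; push_dag.
via (((ε ⊗ a) ∘ (a ⊗ η)) ∘ u); rewrite snake_l; planar.
Qed.

(** The Frobenius equation writes [m†] with one [m] and two cups; capping η' with [s†] collapses it
    to [u]. *)
Lemma dag_frob2_of_l : μ† = ((m ∘ (a ⊗ a' ⊗ u)) ⊗ a) ∘ (a ⊗ η).
Proof.
rewrite /frob2_of; push_dag; rewrite -(tri_frobenius_l frob.1).
via (((m ∘ (a ⊗ a' ⊗ ((a ⊗ s†) ∘ η'))) ⊗ a) ∘ (a ⊗ η)).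
by rewrite conj_state_eta'.
Qed.

Lemma dag_frob2_of_r : μ† = (a ⊗ (m ∘ (u ⊗ a' ⊗ a))) ∘ (η' ⊗ a).
Proof.
rewrite /frob2_of; push_dag; rewrite (tri_frobenius_r frob.1).
via ((a ⊗ (m ∘ (((s† ⊗ a) ∘ η) ⊗ a' ⊗ a))) ∘ (η' ⊗ a)).
by rewrite conj_state_eta.
Qed.

Lemma frob2_of_assoc : μ ∘ (μ ⊗ a) = μ ∘ (a ⊗ μ).
Proof.
rewrite /frob2_of.
via (m ∘ (m ⊗ a' ⊗ a) ∘ (a ⊗ s ⊗ a ⊗ s ⊗ a)).
rewrite -(tri_assoc frob.1); planar.
Qed.

Lemma frob2_of_unitl : μ ∘ (u ⊗ a) = a.
Proof. rewrite -[RHS](tri_unitl frob.2) /frob2_of; planar. Qed.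

Lemma frob2_of_unitr : μ ∘ (a ⊗ u) = a.
Proof. rewrite -[RHS](tri_unitr frob.2) /frob2_of; planar. Qed.

(** With [μ†] in cup form, two nested copies of [m] remain, which associativity regroups. Its mirror
    image has the same right-hand side, giving the Frobenius law. *)
Lemma frob2_of_frobenius_l : (μ ⊗ a) ∘ (a ⊗ μ†) = μ† ∘ μ.
Proof.
rewrite dag_frob2_of_l /frob2_of.
via (((m ∘ (a ⊗ a' ⊗ m)) ⊗ a) ∘ (a ⊗ s ⊗ a ⊗ ((a' ⊗ u ⊗ a) ∘ η))).
rewrite (tri_assoc frob.1); planar.
Qed.

Lemma frob2_of_frobenius_r : (a ⊗ μ) ∘ (μ† ⊗ a) = μ† ∘ μ.
Proof.
rewrite dag_frob2_of_r /frob2_of.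
via ((a ⊗ (m ∘ (m ⊗ a' ⊗ a))) ∘ (((a ⊗ u ⊗ a') ∘ η') ⊗ a ⊗ s ⊗ a)).
rewrite -(tri_assoc frob.1); planar.
Qed.

Lemma dag_tri_hom : t† ∈Hom(A, A').
Proof. apply: dag_hom; hom. Qed.

#[local] Hint Resolve dag_tri_hom : hom.

(** The two cup forms of [μ†] present the form through ε' and through ε with the same [t†].
    Straightening either by a snake yields [t†], whence symmetry. *)
Lemma frob2_of_form_l : u† ∘ μ = ε' ∘ (t† ⊗ a).
Proof.
apply: dag_inj; push_dag; rewrite dag_frob2_of_l; planar.
Qed.

Lemma frob2_of_form_r : u† ∘ μ = ε ∘ (a ⊗ t†).
Proof.
apply: dag_inj; push_dag; rewrite dag_frob2_of_r -/(eta' D); planar.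
Qed.

Lemma frob2_of_invol : invol D μ u = t†.
Proof.
rewrite /invol frob2_of_form_l.
via (((ε' ⊗ a') ∘ (a' ⊗ η')) ∘ t†); rewrite snake_r'; planar.
Qed.

Lemma frob2_of_symmetric : symmetric2 D μ u.
Proof.
rewrite /symmetric2 frob2_of_invol frob2_of_form_r; symmetry.
via (((a' ⊗ ε) ∘ (η ⊗ a')) ∘ t†); rewrite snake_r; planar.
Qed.

Lemma frob2_ofP : symmetric_dagger_frobenius2 D μ u.
Proof.
split; last exact: frob2_of_symmetric.
split; rewrite ?frob2_of_frobenius_l ?frob2_of_frobenius_r //.
- exact: frob2_of_hom.
- exact: frob2_of_assoc.
- exact: frob2_of_unitl.
- exact: frob2_of_unitr.
Qed.

(** On elements: m(m(x,s,m(u,y,u)),s,z) = m(m(m(x,s,u),y,u),s,z) = m(m(x,y,u),s,z) = m(x,y,m(u,s,z))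
    = m(x,y,z). *)
Lemma frob2_ofK : frob3_of D μ u = m.
Proof.
rewrite /frob3_of frob2_of_invol dagK /frob2_of.
via (m ∘ ((m ∘ (a ⊗ a' ⊗ m)) ⊗ a' ⊗ a) ∘ (a ⊗ s ⊗ u ⊗ a' ⊗ u ⊗ s ⊗ a)).
rewrite (tri_assoc frob.1).
via (m ∘ (m ⊗ a' ⊗ a) ∘ ((m ∘ (a ⊗ s ⊗ u)) ⊗ a' ⊗ u ⊗ s ⊗ a)).
rewrite (tri_unitr frob.2) -(tri_assoc frob.1).
via (m ∘ (a ⊗ a' ⊗ (m ∘ (u ⊗ s ⊗ a)))).
rewrite (tri_unitl frob.2); planar.
Qed.

End FromThree.
End Correspondence.

(** * The correspondence and the equivalent conditions *)

Theorem theorem7p1 (C : strict_monoidal_dagger_category) (A A' : ob C)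
    (D : dagger_duality A A') :
  (forall μ u : arr C, symmetric_dagger_frobenius2 D μ u ->
     unital_dagger_frobenius3 D (frob3_of D μ u) u /\ conj_unambiguous D u) /\
  (forall m u : arr C, unital_dagger_frobenius3 D m u -> conj_unambiguous D u ->
     symmetric_dagger_frobenius2 D (frob2_of D m u) u) /\
  (forall μ u : arr C, symmetric_dagger_frobenius2 D μ u ->
     frob2_of D (frob3_of D μ u) u = μ) /\
  (forall m u : arr C, unital_dagger_frobenius3 D m u -> conj_unambiguous D u ->
     frob3_of D (frob2_of D m u) u = m) /\
  (forall μ u : arr C, symmetric_dagger_frobenius2 D μ u ->
     (special A μ <-> normal3 D (frob3_of D μ u)) /\
     (normal3 D (frob3_of D μ u) <->
        left_idempotent D (frob3_of D μ u) \/ right_idempotent D (frob3_of D μ u))).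
Proof.
split; last split; last split; last split.
- move=> μ u [frob sym].
  exact: conj (frob3_ofP frob sym) (conj_unambiguous_unit frob sym).
- exact: frob2_ofP.
- by move=> μ u [frob sym]; exact: frob3_ofK frob sym.
- exact: frob2_ofK.
move=> μ u [frob sym].
have normal := special_normal frob sym.
have left := special_left_idempotent frob sym.
have right := special_right_idempotent frob sym.
tauto.
Qed.
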